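(* Let $S\in\mathcal M_d(\mathbb C)^+$, let $\mathbf a=(a_i)_{i\in\mathbb I_k}\in(\mathbb R^k_{>0})^\downarrow$, and let $N$ be a strictly convex unitarily invariant norm on $\mathcal M_d(\mathbb C)$. Let $\mathcal G_0=\{g_i\}_{i\in\mathbb I_k}\in\mathbb T_d(\mathbf a)$ be a local minimizer of $\Theta:\mathbb T_d(\mathbf a)\to\mathbb R_{\ge0}$, $\Theta(\mathcal G)=N(S-S_{\mathcal G})$, with frame operator $S_0=S_{\mathcal G_0}$. Let $W=R(S_0)$ be the range of $S_0$ (which reduces $S-S_0$), let $\sigma((S-S_0)|_W)=\{c_1,\dots,c_p\}$ with $c_1<c_2<\dots<c_p$, and let $J_j=\{\ell\in\mathbb I_k:(S-S_0)g_\ell=c_j\,g_\ell\}$ for $j\in\mathbb I_p$. Let $j\in\mathbb I_p$ and assume that there exists $c\in\sigma(S-S_0)$ such that $c_j<c$. Then the family $\{g_i\}_{i\in J_j}$ is linearly independent.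
   Context: $\mathbb I_n=\{1,\dots,n\}$. $\mathcal M_d(\mathbb C)$ is the algebra of complex $d\times d$ matrices and $\mathcal M_d(\mathbb C)^+$ the cone of positive semidefinite matrices. $\sigma(\cdot)$ denotes the spectrum. $(\mathbb R^k_{>0})^\downarrow$ is the set of vectors in $\mathbb R^k$ with positive entries in non-increasing order. For $x,y\in\mathbb C^d$, $(x\otimes y)z=\langle z,y\rangle x$. A norm $N$ is unitarily invariant if $N(UAV)=N(A)$ for all $A\in\mathcal M_d(\mathbb C)$ and all unitary $U,V$. $\mathbb T_d(\mathbf a)=\{\mathcal G=\{g_i\}_{i\in\mathbb I_k}\in(\mathbb C^d)^k:\|g_i\|^2=a_i\text{ for every }i\in\mathbb I_k\}$, with the metric $d(\mathcal G,\mathcal G')=\max\{\|g_i-g_i'\|:i\in\mathbb I_k\}$. The frame operator of $\mathcal G=\{g_i\}_{i\in\mathbb I_k}$ is $S_{\mathcal G}=\sum_{i\in\mathbb I_k}g_i\otimes g_i$. A subspace reduces a selfadjoint operator if it is invariant under it. *)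

(* Defs.v *)
From HB Require Import structures.
Set Warnings "-notation-overridden,-ambiguous-paths".
From mathcomp Require Import all_boot all_order all_algebra.
From mathcomp Require Import reals.
From mathcomp Require Export spectral.
From mathcomp Require Export complex.

Set Implicit Arguments.
Unset Strict Implicit.
Unset Printing Implicit Defensive.

Import Order.TTheory GRing.Theory Num.Theory.
Local Open Scope ring_scope.
Local Open Scope complex_scope.
Local Open Scope sesquilinear_scope.

(* Vectors of C^d are columns; a matrix acts on them by left multiplication.
   The field of complex numbers is R[i] over the reals R. *)

(* Linear in the first argument, conjugate-linear in the second. *)
Definition inner (R : realType) (d : nat) (u v : 'cV[R[i]]_d) : R[i] :=
  (v ^t* *m u) 0 0.

Definition vnorm (R : realType) (d : nat) (u : 'cV[R[i]]_d) : R :=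
  Num.sqrt (complex.Re (inner u u)).

Definition rank_one (R : realType) (d : nat) (x y : 'cV[R[i]]_d) : 'M[R[i]]_d :=
  x *m y ^t*.

Lemma rank_oneE (R : realType) (d : nat) (x y z : 'cV[R[i]]_d) :
  rank_one x y *m z = inner z y *: x.
Proof.
by rewrite /rank_one -mulmxA [_ *m z]mx11_scalar mul_mx_scalar.
Qed.

Definition psdmx (R : realType) (d : nat) (A : 'M[R[i]]_d) : Prop :=
  A \is hermsymmx /\ forall x : 'cV[R[i]]_d, 0 <= inner (A *m x) x.

Definition is_norm (R : realType) (d : nat) (N : 'M[R[i]]_d -> R) : Prop :=
  [/\ forall A, 0 <= N A,
      forall A, N A = 0 -> A = 0,
      forall (z : R[i]) A, N (z *: A) = complex.Re `|z| * N A
    & forall A B, N (A + B) <= N A + N B].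

Definition unitarily_invariant (R : realType) (d : nat)
    (N : 'M[R[i]]_d -> R) : Prop :=
  forall A U V : 'M[R[i]]_d, U \is unitarymx -> V \is unitarymx ->
    N (U *m A *m V) = N A.

(* The unit sphere of N contains no nondegenerate segment. *)
Definition strictly_convex_norm (R : realType) (d : nat)
    (N : 'M[R[i]]_d -> R) : Prop :=
  forall (A B : 'M[R[i]]_d) (t : R), N A = 1 -> N B = 1 -> A != B ->
    0 < t < 1 -> N (t%:C *: A + (1 - t)%:C *: B) < 1.

Definition torus (R : realType) (d k : nat) (a : 'I_k -> R)
    (G : 'I_k -> 'cV[R[i]]_d) : Prop :=
  forall i, vnorm (G i) ^+ 2 = a i.

Definition family_dist (R : realType) (d k : nat)
    (G G' : 'I_k -> 'cV[R[i]]_d) : R :=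
  \big[Num.max/0]_(i < k) vnorm (G i - G' i).

Definition frame_op (R : realType) (d k : nat)
    (G : 'I_k -> 'cV[R[i]]_d) : 'M[R[i]]_d :=
  \sum_(i < k) rank_one (G i) (G i).

Definition Theta (R : realType) (d k : nat) (N : 'M[R[i]]_d -> R)
    (S : 'M[R[i]]_d) (G : 'I_k -> 'cV[R[i]]_d) : R :=
  N (S - frame_op G).

Definition local_minimizer (R : realType) (X : Type) (D : X -> Prop)
    (dist : X -> X -> R) (f : X -> R) (x0 : X) : Prop :=
  D x0 /\ exists2 e : R, 0 < e &
    forall x, D x -> dist x0 x < e -> f x0 <= f x.

Definition mx_op (R : realType) (d : nat) (A : 'M[R[i]]_d) :
    'End('cV[R[i]]_d) :=
  linfun (mulmx A : 'cV[R[i]]_d -> 'cV[R[i]]_d).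

(* The projection vsproj only makes this a total operation: see restrictionE
   for an invariant W. *)
Definition restriction (F : fieldType) (V : vectType F) (f : 'End(V))
    (W : {vspace V}) : 'End(subvs_of W) :=
  linfun (vsproj W \o f \o vsval).

Lemma restrictionE (F : fieldType) (V : vectType F) (f : 'End(V))
    (W : {vspace V}) (u : subvs_of W) :
  (f @: W <= W)%VS -> vsval (restriction f W u) = f (vsval u).
Proof.
move=> fW; rewrite lfunE /= vsprojK //.
by apply: (subvP fW); apply: memv_img; apply: subvsP.
Qed.

(* Main.v *)
Require Import Defs.
From HB Require Import structures.
Set Warnings "-notation-overridden,-ambiguous-paths".
From mathcomp Require Import all_boot all_order all_algebra.
From mathcomp Require Import reals.
From mathcomp Require Import ring lra.

Set Implicit Arguments.
Unset Strict Implicit.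
Unset Printing Implicit Defensive.

Import Order.TTheory GRing.Theory Num.Theory.
Local Open Scope ring_scope.
Local Open Scope complex_scope.

(** Let [A = S - S0] and suppose that the [g l], [l \in J j], all eigenvectors of
    [A] for [c_j], satisfy a nontrivial relation [sum z_l g_l = 0]. Let [h] be a
    unit eigenvector of [A] for an eigenvalue [x > c_j]; it is orthogonal to
    these [g l]. Rotate each [g l] toward [h] inside the plane that they span,

      [g'_l = cos theta_l g_l + w_l h],  [|w_l|^2 = a_l sin^2 theta_l],

    which keeps the norms [a_l]. The mixed terms of the new frame operator are
    [sum cos theta_l w_l^* g_l h^*] and its adjoint. Choosing angle and phase such
    that [cos theta_l w_l^* = q z_l] with one small [q > 0] for all [l] makes them a
    multiple of [sum z_l g_l = 0], so that exactly

      [S - S_{g'} = A + sum_l b_l (u_l u_l^* - h h^* )],  [b_l = a_l sin^2 theta_l],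

    where [u_l] is the unit vector along [g_l] ([exists_tilt]).

    This moves weight from the eigenvalue [x] to the smaller eigenvalue [c_j] and
    therefore lowers [N]: if [U] is the reflection that exchanges the orthonormal
    vectors [u_l] and [h], then [U A U = A + (x - c_j) (u_l u_l^* - h h^* )]
    ([exists_swap_unitary]), so for [0 < r < x - c_j] the operator
    [A + r (u_l u_l^* - h h^* )] is a proper convex combination of the distinct
    operators [A] and [U A U] of equal norm, and has a smaller norm by strict
    convexity ([norm_transfer_lt]). With [r = sum_l b_l], the perturbed operator
    is the convex combination of these with weights [b_l / r]
    ([dependency_decreases_norm]). As [q] can be taken arbitrarily small, [g] is
    no local minimizer. *)

(** * Linear combinations of four matrices *)

(** In these identities [P], [Q], [X], [Y] stand for [u u^*], [h h^*], [u h^*],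
    [h u^*]. They are separated from their uses because they hold over every
    commutative ring, whereas the field of complex numbers and the entries of
    rank-one matrices would unfold during a computation by entries. The
    unsimplified coefficients are those that [rank_one_comb] produces. *)
Section Combinations.
Variables (F : comNzRingType) (d : nat).
Implicit Types A P Q X Y : 'M[F]_d.

Lemma swap_combination A P Q X Y (b c n : F) : n = -1 ->
  A - ((1 * b) *: P + (1 * (- c)) *: X + (n * b) *: Y + (n * (- c)) *: Q)
    - ((b * 1) *: P + (b * n) *: X + (- c * 1) *: Y + (- c * n) *: Q
       - (b + c) *: ((1 * 1) *: P + (1 * n) *: X + (n * 1) *: Y + (n * n) *: Q))
  = A + (c - b) *: (P - Q).
Proof. by move=> ->; apply/matrixP => i j; rewrite !mxE; ring. Qed.

Lemma rotation_combination P Q X Y (s t w w' r : F) : s * s = 1 - t -> w * w' = r ->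
  (s * s) *: P + (s * w') *: X + (w * s) *: Y + (w * w') *: Q
  = P - t *: P + s *: (w' *: X + w *: Y) + r *: Q.
Proof. by move=> -> ->; apply/matrixP => i j; rewrite !mxE; ring. Qed.

Lemma tilt_combination P Q X (q t r : F) :
  P - (P - t *: P + q *: X + r *: Q) = t *: P - r *: Q - q *: X.
Proof. by apply/matrixP => i j; rewrite !mxE; ring. Qed.
End Combinations.

(** * The inner product and rank-one operators *)

Section Inner.
Variables (R : realType) (d : nat).
Implicit Types (u v w x y : 'cV[R[i]]_d) (z : R[i]) (A : 'M[R[i]]_d).

Lemma conjC_real (r : R) : (r%:C^*)%R = r%:C.
Proof. exact: conjc_real. Qed.

Lemma mul_conjC_real z : z * (z^*)%R = (complex.Re (z * (z^*)%R))%:C.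
Proof. by rewrite RRe_real // ger0_real // mul_conjC_ge0. Qed.

Lemma Re_mul_conjC_ge0 z : 0 <= complex.Re (z * (z^*)%R).
Proof. by rewrite -ler0c -mul_conjC_real mul_conjC_ge0. Qed.

Lemma rank_one_adj x y : ((rank_one x y) ^t*)%sesqui = rank_one y x.
Proof. by rewrite /rank_one trmx_mul map_mxM trmxCK. Qed.

Lemma rank_oneDl x y w : rank_one (x + y) w = rank_one x w + rank_one y w.
Proof. exact: mulmxDl. Qed.

Lemma rank_oneZl z x y : rank_one (z *: x) y = z *: rank_one x y.
Proof. by rewrite /rank_one scalemxAl. Qed.

Lemma rank_oneDr x y w : rank_one w (x + y) = rank_one w x + rank_one w y.
Proof. by rewrite -[LHS]rank_one_adj rank_oneDl linearD map_mxD /= !rank_one_adj. Qed.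

Lemma rank_oneZr z x y : rank_one x (z *: y) = (z^*)%R *: rank_one x y.
Proof. by rewrite -[LHS]rank_one_adj rank_oneZl linearZ map_mxZ /= rank_one_adj. Qed.

Lemma rank_one0l x : rank_one 0 x = 0.
Proof. exact: mul0mx. Qed.

Lemma rank_one0r x : rank_one x 0 = 0.
Proof. by rewrite /rank_one trmx0 map_mx0 mulmx0. Qed.

Lemma rank_one_suml (I : finType) (f : I -> 'cV[R[i]]_d) x :
  \sum_i rank_one (f i) x = rank_one (\sum_i f i) x.
Proof.
symmetry; apply: (big_morph (fun u => rank_one u x)).
- by move=> u v; apply: rank_oneDl.
- exact: rank_one0l.
Qed.

Lemma rank_one_sumr (I : finType) (f : I -> 'cV[R[i]]_d) x :
  \sum_i rank_one x (f i) = rank_one x (\sum_i f i).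
Proof.
symmetry; apply: (big_morph (fun u => rank_one x u)).
- by move=> u v; apply: rank_oneDr.
- exact: rank_one0r.
Qed.

Lemma innerDl u v w : inner (u + v) w = inner u w + inner v w.
Proof. by rewrite /inner mulmxDr !mxE. Qed.

Lemma innerZl z u w : inner (z *: u) w = z * inner u w.
Proof. by rewrite /inner -scalemxAr !mxE. Qed.

Lemma innerC u v : inner v u = ((inner u v)^*)%R.
Proof.
rewrite /inner !mxE rmorph_sum; apply: eq_bigr => i _.
by rewrite !mxE rmorphM /= conjCK mulrC.
Qed.

Lemma innerDr u v w : inner w (u + v) = inner w u + inner w v.
Proof. by rewrite [LHS]innerC innerDl rmorphD /= -!innerC. Qed.

Lemma innerZr z u w : inner w (z *: u) = (z^*)%R * inner w u.
Proof. by rewrite [LHS]innerC innerZl rmorphM /= -!innerC. Qed.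

Lemma inner_self_ge0 u : 0 <= inner u u.
Proof.
rewrite /inner !mxE; apply: sumr_ge0 => i _.
by rewrite !mxE mulrC mul_conjC_ge0.
Qed.

Lemma inner_self_eq0 u : inner u u = 0 -> u = 0.
Proof.
move/eqP; rewrite /inner !mxE psumr_eq0 => [/allP h|i _]; last first.
  by rewrite !mxE mulrC mul_conjC_ge0.
apply/matrixP => i j; rewrite ord1 !mxE.
by have := h i (mem_index_enum i); rewrite !mxE mulrC mul_conjC_eq0 => /eqP.
Qed.

Lemma inner_self_vnorm u : inner u u = (vnorm u ^+ 2)%:C.
Proof.
have h := inner_self_ge0 u.
rewrite /vnorm sqr_sqrtr ?RRe_real ?ger0_real //.
by rewrite -ler0c RRe_real ?ger0_real.
Qed.

Lemma rank_one_comb (z1 w1 z2 w2 : R[i]) u v :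
  rank_one (z1 *: u + w1 *: v) (z2 *: u + w2 *: v)
  = (z1 * (z2^*)%R) *: rank_one u u + (z1 * (w2^*)%R) *: rank_one u v
    + (w1 * (z2^*)%R) *: rank_one v u + (w1 * (w2^*)%R) *: rank_one v v.
Proof.
rewrite rank_oneDl !rank_oneDr !rank_oneZl !rank_oneZr !scalerA.
by rewrite addrA.
Qed.

Lemma hermsymmxP A : reflect (A = (A ^t*)%sesqui) (A \is hermsymmx).
Proof. by rewrite is_hermitianmxE expr0 scale1r; apply: eqP. Qed.

Lemma hermitian_sub A B : A \is hermsymmx -> B \is hermsymmx ->
  A - B \is hermsymmx.
Proof.
move=> /hermsymmxP hA /hermsymmxP hB; apply/hermsymmxP.
by rewrite {1}hA {1}hB linearB map_mxB.
Qed.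

Lemma hermitian_frame_op k (g : 'I_k -> 'cV[R[i]]_d) : frame_op g \is hermsymmx.
Proof.
apply/hermsymmxP; rewrite /frame_op (linear_sum trmx) (raddf_sum (map_mx Num.conj)).
by apply: eq_bigr => i _; rewrite [RHS]rank_one_adj.
Qed.

Lemma hermitian_inner A u v : A \is hermsymmx ->
  inner (A *m u) v = inner u (A *m v).
Proof.
move=> /hermsymmxP => hA.
by rewrite /inner trmx_mul map_mxM -hA mulmxA.
Qed.

Lemma hermitian_eigen_orth A u v (b c : R) : A \is hermsymmx ->
  A *m u = b%:C *: u -> A *m v = c%:C *: v -> b != c -> inner u v = 0.
Proof.
move=> hA hu hv bc; have := hermitian_inner u v hA.
rewrite hu hv innerZl innerZr conjC_real => /eqP.
rewrite -subr_eq0 -mulrBl mulf_eq0 subr_eq0 => /orP[/eqP/complexI e|/eqP //].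
by rewrite e eqxx in bc.
Qed.

(** The reflection [1 - v v^*] along [v = u - h] exchanges the orthonormal
    vectors [u] and [h] (note that [v^* v = 2]), hence conjugating [A] by it
    exchanges the eigenvalues [b] and [c] that [A] takes on them. *)
Lemma exists_swap_unitary A u h (b c : R) : A \is hermsymmx ->
  inner u u = 1 -> inner h h = 1 -> inner u h = 0 ->
  A *m u = b%:C *: u -> A *m h = c%:C *: h ->
  exists2 U : 'M[R[i]]_d, U \is unitarymx &
    U *m A *m U = A + (c - b)%:C *: (rank_one u u - rank_one h h).
Proof.
move=> hA uu hh uh Au Ah.
have hu : inner h u = 0 by rewrite innerC uh conjC0.
set v := u - h; set m := b%:C *: u - c%:C *: h.
have vE : v = 1 *: u + (-1) *: h by rewrite scale1r scaleN1r.
have mE : m = b%:C *: u + (- c%:C) *: h by rewrite scaleNr.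
have vv : inner v v = 2.
  rewrite vE !(innerDl, innerDr, innerZl, innerZr) uu hh uh hu.
  by rewrite rmorphN rmorph1; ring.
have mv : inner m v = (b + c)%:C.
  rewrite vE mE !(innerDl, innerDr, innerZl, innerZr) uu hh uh hu.
  by rewrite rmorphN rmorph1 rmorphD; ring.
have Av : A *m v = m by rewrite mulmxBr Au Ah.
have vA : (v ^t*)%sesqui *m A = (m ^t*)%sesqui.
  have /hermsymmxP := hA => hA'.
  by rewrite -Av trmx_mul map_mxM -hA'.
have vAr w : rank_one w v *m A = rank_one w m.
  by rewrite /rank_one -mulmxA vA.
have rr w x y (z : 'cV_d) : rank_one w x *m rank_one y z = inner y x *: rank_one w z.
  by rewrite /rank_one mulmxA -/(rank_one w x) rank_oneE scalemxAl.
have vm : inner v m = (b + c)%:C.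
  by rewrite innerC mv conjC_real.
exists (1%:M - rank_one v v).
  apply/unitarymxP.
  have -> : ((1%:M - rank_one v v) ^t*)%sesqui = 1%:M - rank_one v v.
    by rewrite linearB map_mxB /= rank_one_adj trmx1 map_mx1.
  rewrite mulmxBl !mulmxBr !mul1mx mulmx1 rr vv.
  by apply/matrixP => i j; rewrite !mxE; ring.
rewrite mulmxBl mul1mx vAr mulmxBr mulmx1 mulmxBl rr.
have -> : A *m rank_one v v = rank_one m v by rewrite /rank_one mulmxA Av.
rewrite vm.
have c1 : (1^*)%R = 1 :> R[i] by apply: rmorph1.
have cN1 : ((-1)^*)%R = -1 :> R[i] by rewrite rmorphN rmorph1.
have cNc : ((- c%:C)^*)%R = - c%:C by rewrite rmorphN /= conjC_real.
have cB : (c - b)%:C = c%:C - b%:C by apply: rmorphB.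
have bD : (b + c)%:C = b%:C + c%:C by apply: rmorphD.
have rvm := rank_one_comb 1 (-1) b%:C (- c%:C) u h.
have rmv := rank_one_comb b%:C (- c%:C) 1 (-1) u h.
have rvv := rank_one_comb 1 (-1) 1 (-1) u h.
rewrite -vE -?mE in rvm rmv rvv.
clearbody v m; rewrite rvm rmv rvv conjC_real cNc c1 cN1 cB bD.
exact: swap_combination.
Qed.
End Inner.

(** * Strictly convex unitarily invariant norms *)

Section Norm.
Variables (R : realType) (d : nat) (N : 'M[R[i]]_d -> R).
Implicit Types (A B : 'M[R[i]]_d).
Hypothesis Nnorm : is_norm N.

Lemma normZ_real (r : R) A : 0 <= r -> N (r%:C *: A) = r * N A.
Proof.
by move=> r0; case: Nnorm => _ _ -> _; rewrite ger0_norm ?ler0c.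
Qed.

Lemma norm_sum (I : finType) (X : I -> 'M[R[i]]_d) :
  N (\sum_i X i) <= \sum_i N (X i).
Proof.
case: (Nnorm) => _ _ _ ND; elim/big_ind2: _ => //.
- by have := normZ_real 0 (lexx 0); rewrite scaler0 mul0r => ->.
- by move=> A a B b hA hB; apply: le_trans (ND _ _) (lerD hA hB).
Qed.

Lemma norm_convex_lt (I : finType) (p : I -> R) (X : I -> 'M[R[i]]_d) (r : R) :
  (forall i, 0 <= p i) -> \sum_i p i = 1 ->
  (forall i, 0 < p i -> N (X i) < r) ->
  N (\sum_i (p i)%:C *: X i) < r.
Proof.
move=> p0 p1 hX; apply: le_lt_trans (norm_sum _) _.
under eq_bigr do rewrite normZ_real //.
have -> : r = \sum_i p i * r by rewrite -mulr_suml p1 mul1r.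
have [i pi]: exists i, 0 < p i.
  apply/existsP; apply: contraT => /existsPn h.
  have : \sum_i p i = 0.
    by apply: big1 => i _; apply/eqP; rewrite eq_le p0 leNgt h.
  by rewrite p1 => /eqP; rewrite oner_eq0.
rewrite [ltLHS](bigD1 i) // [ltRHS](bigD1 i) //=.
apply: ltr_leD; first by rewrite ltr_pM2l // hX.
apply: ler_sum => l _; have := p0 l; rewrite le_eqVlt => /orP[/eqP<-|pl].
  by rewrite !mul0r.
by rewrite ler_pM2l // ltW // hX.
Qed.

Lemma strictly_convex_norm_lt A B (t : R) : strictly_convex_norm N ->
  N B = N A -> A != B -> 0 < t < 1 -> N (t%:C *: A + (1 - t)%:C *: B) < N A.
Proof.
move=> Nsc NBA AB t01; case: (Nnorm) => N0 Neq0 _ _.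
have NA : 0 < N A.
  rewrite lt_def N0 andbT; apply: contra_neq AB => NA0.
  by rewrite (Neq0 _ NA0) (Neq0 B) // NBA.
have r0 : 0 <= (N A)^-1 by rewrite invr_ge0.
have rN0 : ((N A)^-1)%:C != 0 :> R[i].
  by rewrite -[0]/(0%:C) (inj_eq (@complexI R)) invr_neq0 // gt_eqF.
have := Nsc (((N A)^-1)%:C *: A) (((N A)^-1)%:C *: B) t.
rewrite !normZ_real // NBA mulVf ?gt_eqF // => /(_ erefl erefl).
rewrite (inj_eq (scalerI rN0)) => /(_ AB t01).
have -> : t%:C *: (((N A)^-1)%:C *: A) + (1 - t)%:C *: (((N A)^-1)%:C *: B)
   = ((N A)^-1)%:C *: (t%:C *: A + (1 - t)%:C *: B).
  by rewrite scalerDr !scalerA ![((N A)^-1)%:C * _]mulrC.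
by rewrite normZ_real // mulrC ltr_pdivrMr // mul1r.
Qed.

(** Moving weight [r] from the eigenvalue [c] to the smaller eigenvalue [b]
    averages [A] with its conjugate under the swap of [u] and [h], which has
    the same norm as [A]; the average is nontrivial as long as [r < c - b]. *)
Lemma norm_transfer_lt A u h (b c r : R) :
  strictly_convex_norm N -> unitarily_invariant N ->
  A \is hermsymmx -> inner u u = 1 -> inner h h = 1 ->
  A *m u = b%:C *: u -> A *m h = c%:C *: h -> 0 < r < c - b ->
  N (A + r%:C *: (rank_one u u - rank_one h h)) < N A.
Proof.
move=> Nsc Nui hA uu hh Au Ah /andP[r0 rcb].
have cb : 0 < c - b by apply: lt_trans rcb.
have uh : inner u h = 0.
  by apply: (hermitian_eigen_orth hA Au Ah); rewrite lt_eqF // -subr_gt0.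
have [U Uu UAU] := exists_swap_unitary hA uu hh uh Au Ah.
have cbN0 : (c - b)%:C != 0 :> R[i].
  by rewrite -[0]/(0%:C) (inj_eq (@complexI R)) gt_eqF.
set D := rank_one u u - rank_one h h in UAU *.
have D0 : D != 0.
  apply/eqP => D0; have : D *m u = u.
    by rewrite mulmxBl !rank_oneE uu uh scale1r scale0r subr0.
  rewrite D0 mul0mx => u0; move/eqP: uu.
  by rewrite -u0 /inner mulmx0 mxE eq_sym oner_eq0.
have -> : A + r%:C *: D = (1 - r / (c - b))%:C *: A
     + (1 - (1 - r / (c - b)))%:C *: (U *m A *m U).
  have {1}-> : r = r / (c - b) * (c - b) by rewrite divfK // gt_eqF.
  rewrite UAU !rmorphB rmorph1 rmorphM /=; clear UAU D0; move: D => D.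
  by apply/matrixP => i j; rewrite !mxE; ring.
apply: strictly_convex_norm_lt => //.
- by rewrite Nui.
- rewrite UAU -subr_eq0 opprD addrA subrr sub0r oppr_eq0 scaler_eq0.
  by rewrite (negPf cbN0) (negPf D0).
- have : 0 < r / (c - b) < 1 by rewrite divr_gt0 // ltr_pdivrMr // mul1r.
  by move=> /andP[? ?]; lra.
Qed.
End Norm.

(** * Rotating a vector toward an orthogonal direction *)

Section Rotation.
Variables (R : realType) (d : nat).
Implicit Types (u v h : 'cV[R[i]]_d) (w : R[i]).

Definition normalized (a : R) u := ((Num.sqrt a)^-1)%:C *: u.

Lemma sqr_sqrtrV (a : R) : 0 < a -> (Num.sqrt a)^-1 * (Num.sqrt a)^-1 = a^-1.
Proof. by move=> a0; rewrite -expr2 exprVn sqr_sqrtr // ltW. Qed.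

Lemma inner_normalized (a : R) u : 0 < a -> inner u u = a%:C ->
  inner (normalized a u) (normalized a u) = 1.
Proof.
move=> a0 uu; rewrite innerZl innerZr conjC_real uu mulrA -!rmorphM /=.
by rewrite sqr_sqrtrV // mulVf ?gt_eqF.
Qed.

Lemma rank_one_normalized (a : R) u : 0 < a ->
  rank_one (normalized a u) (normalized a u) = (a^-1)%:C *: rank_one u u.
Proof.
move=> a0; rewrite rank_oneZl rank_oneZr conjC_real scalerA -rmorphM /=.
by rewrite sqr_sqrtrV.
Qed.

(** With [t = sin^2 x] and [1 - t = cos^2 x], this prescribes the product
    [sin x cos x], on the branch [x <= pi / 4]. *)
Lemma sin_sqr_of_sin_cos_sqr (y : R) : 0 <= y -> 4 * y <= 1 ->
  exists t : R, [/\ 0 <= t, t <= 2 * y, t <= 1 / 2 & t * (1 - t) = y].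
Proof.
move=> y0 y1; exists ((1 - Num.sqrt (1 - 4 * y)) / 2).
set q := Num.sqrt _; have q0 : 0 <= q by apply: sqrtr_ge0.
have q2 : q * q = 1 - 4 * y by rewrite -expr2 sqr_sqrtr // subr_ge0.
have q1 : q <= 1 by nra.
by split; [lra | nra | lra | nra].
Qed.

(** In [cos x u + sin x h] the coefficients are [s = sqrt (1 - t)] and, up to a
    factor [sqrt a] and a free phase, [w]. The bound on the displacement is
    [(1 - cos x)^2 + sin^2 x <= 2 sin^2 x]. *)
Lemma rotate_toward (a t : R) u h w :
  0 <= t <= 1 -> inner u u = a%:C -> inner h h = 1 -> inner u h = 0 ->
  w * (w^*)%R = (a * t)%:C ->
  let s := Num.sqrt (1 - t) in
  let u' := s%:C *: u + w *: h in
  [/\ inner u' u' = a%:C, vnorm (u - u') ^+ 2 <= 2 * (t * a) &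
     rank_one u' u' = rank_one u u - t%:C *: rank_one u u
       + s%:C *: ((w^*)%R *: rank_one u h + w *: rank_one h u)
       + (a * t)%:C *: rank_one h h].
Proof.
move=> /andP[t0 t1] uu hh uh ww s u'.
have hu : inner h u = 0 by rewrite innerC uh conjC0.
have s0 : 0 <= s by apply: sqrtr_ge0.
have s2 : s * s = 1 - t by rewrite -expr2 sqr_sqrtr // subr_ge0.
have a0 : 0 <= a by rewrite -ler0c -uu inner_self_ge0.
have self (r : R) : inner (r%:C *: u + w *: h) (r%:C *: u + w *: h)
    = (r * r * a + a * t)%:C.
  rewrite !(innerDl, innerDr, innerZl, innerZr) uu hh uh hu conjC_real.
  by rewrite !mulr0 mulr1 addr0 add0r ww mulrA -!rmorphM -rmorphD.
split.
- by rewrite self; congr (_%:C); rewrite s2; ring.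
- have -> : vnorm (u - u') = vnorm ((s - 1)%:C *: u + w *: h).
    have -> : u - u' = (-1) *: ((s - 1)%:C *: u + w *: h).
      by rewrite rmorphB rmorph1; apply/matrixP => i j; rewrite !mxE; ring.
    by rewrite /vnorm innerZl innerZr rmorphN rmorph1 mulrA mulrNN !mulr1 mul1r.
  rewrite -lecR -inner_self_vnorm self lecR.
  have s1 : s <= 1 by nra.
  have : (s - 1) * (s - 1) <= t by nra.
  by move=> /(ler_wpM2r a0); lra.
- rewrite rank_one_comb conjC_real; apply: rotation_combination => //.
  by rewrite -rmorphM /= s2 rmorphB rmorph1.
Qed.
End Rotation.

(** * Linear dependence and eigenvectors *)

Lemma small_pos (R : realType) (x : R) : 0 <= x ->
  exists2 r : R, 0 < r & r * x < 1.
Proof.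
move=> x0; exists (1 + x)^-1; first by rewrite invr_gt0; lra.
by rewrite mulrC ltr_pdivrMr; lra.
Qed.

(** A relation among the [f i], [i] in [A], is more convenient as one among all
    the [f i] whose coefficients vanish outside of [A]. *)
Lemma free_map_enum (F : fieldType) (V : vectType F) (I : finType)
    (A : {set I}) (f : I -> V) :
  (forall z : I -> F, (forall i, i \notin A -> z i = 0) ->
    \sum_i z i *: f i = 0 -> forall i, z i = 0) ->
  free [seq f i | i <- enum A].
Proof.
move=> h; have sz : size [seq f i | i <- enum A] == #|A|.
  by rewrite size_map -cardE.
suff : free (Tuple sz) by [].
apply/freeP => k ksum.
(* Outside of A the index is #|A|, where insub fails and z vanishes. *)
pose z i := if insub (index i (enum A)) is Some m then k m else 0.
have zE (m : 'I_#|A|) : z (enum_val m) = k m.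
  by rewrite /z /enum_val index_uniq ?enum_uniq -?cardE // valK.
have z0 i : i \notin A -> z i = 0.
  move=> iA; rewrite /z insubN // -leqNgt cardE.
  by rewrite memNindex // mem_enum.
move=> m; rewrite -zE; apply: h => //.
rewrite (bigID (mem A)) /= [X in _ + X]big1 ?addr0; last first.
  by move=> i /z0 ->; rewrite scale0r.
rewrite -[RHS]ksum big_enum_val; apply: eq_bigr => l _.
rewrite zE /enum_val; congr (_ *: _).
by rewrite (nth_map (enum_default l)) // -cardE.
Qed.

Lemma leigenvalue_mx_op (R : realType) (d : nat) (A : 'M[R[i]]_d) (x : R[i]) :
  passmx.leigenvalue (mx_op A) x -> exists2 h : 'cV[R[i]]_d, h != 0 & A *m h = x *: h.
Proof.
rewrite /passmx.leigenvalue -vpick0 => h0; exists (vpick (passmx.leigenspace (mx_op A) x)) => //.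
have := memv_pick (passmx.leigenspace (mx_op A) x).
by rewrite memv_ker !lfunE /= opp_lfunE lfunE /= lfunE /= subr_eq0 lfunE /= => /eqP.
Qed.

(** * Decreasing the norm along a linear dependency *)

Section Perturbation.
Variables (R : realType) (d : nat).
Implicit Types (u h : 'cV[R[i]]_d) (z : R[i]).

(** The angle of the rotation of [u] toward [h] is chosen so that the part of
    [rank_one u' u'] that mixes [u] and [h] is linear in the dependency
    coefficient [z], with the same factor [q] for every member of a family;
    the mixed parts then cancel exactly when summed over a dependency. *)
Lemma exists_tilt (a q : R) u h z :
  0 < a -> 0 < q -> inner u u = a%:C -> inner h h = 1 ->
  (z != 0 -> inner u h = 0) ->
  let m := complex.Re (z * (z^*)%R) in
  4 * (q ^+ 2 * (m / a)) <= 1 ->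
  exists t : R, exists u' : 'cV[R[i]]_d,
  [/\ [/\ 0 <= t, z != 0 -> 0 < t & a * t <= 2 * (q ^+ 2 * m)], z = 0 -> t = 0,
     inner u' u' = a%:C, vnorm (u - u') ^+ 2 <= 4 * (q ^+ 2 * m) &
     rank_one u' u' = rank_one u u - t%:C *: rank_one u u
       + q%:C *: (rank_one (z *: u) h + rank_one h (z *: u))
       + (a * t)%:C *: rank_one h h].
Proof.
move=> a0 q0 uu hh uh m; have [z0|z0] := eqVneq z 0.
  move=> _; exists 0, u; have -> : m = 0 by rewrite /m z0 mul0r.
  have v0 : vnorm (u - u) = 0 by rewrite subrr /vnorm /inner mulmx0 mxE /complex.Re sqrtr0.
  rewrite v0 expr0n /= !mulr0.
  split => //; rewrite rmorph0 !scale0r z0 scale0r rank_one0l rank_one0r.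
  by rewrite !addr0 subr0 scaler0 addr0.
have m0 : 0 < m.
  rewrite lt_def Re_mul_conjC_ge0 andbT; apply: contra_neq z0 => m0.
  by apply/eqP; rewrite -mul_conjC_eq0 mul_conjC_real -/m m0.
move=> hq; have [|t [t0 ty t2 ht]] := sin_sqr_of_sin_cos_sqr _ hq.
  by rewrite mulr_ge0 ?sqr_ge0 // divr_ge0 // ltW.
have aE : a * (t * (1 - t)) = q ^+ 2 * m.
  by rewrite ht; field; rewrite gt_eqF.
have tpos : 0 < t.
  rewrite lt_def t0 andbT; apply/eqP => t00.
  have : 0 < q ^+ 2 * m by rewrite mulr_gt0 // exprn_gt0.
  by rewrite -aE t00 mul0r mulr0 ltxx.
have aty : a * t <= 2 * (q ^+ 2 * m).
  by rewrite -aE; have := ltW a0; nra.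
set s := Num.sqrt (1 - t).
have s0 : 0 < s by rewrite sqrtr_gt0; lra.
have s2 : s ^+ 2 = 1 - t by rewrite sqr_sqrtr //; lra.
(* The cross term of u' u'^* is s w^* u h^*, which has to be q z u h^*. *)
pose w := (q / s)%:C * (z^*)%R.
have wc : (w^*)%R = (q / s)%:C * z by rewrite rmorphM /= conjC_real conjCK.
have ww : w * (w^*)%R = (a * t)%:C.
  rewrite wc /w mulrACA [_ * z]mulrC mul_conjC_real -/m -!rmorphM /=.
  congr (_%:C); apply: (@mulfI _ (s ^+ 2)); first by rewrite expf_neq0 ?gt_eqF.
  have -> : s ^+ 2 * (q / s * (q / s) * m) = q ^+ 2 * m.
    by field; rewrite gt_eqF.
  by rewrite -aE s2; ring.
have t01 : 0 <= t <= 1 by apply/andP; split; lra.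
have [] := rotate_toward t01 uu hh (uh z0) ww.
rewrite -/s /=; set u' := _ + _ => u'u' dist rk.
exists t, u'; split.
- by split.
- by move=> zz; rewrite zz eqxx in z0.
- exact: u'u'.
- by apply: le_trans dist _; lra.
have sqs : s%:C * (q / s)%:C = q%:C.
  by rewrite -rmorphM /= mulrCA divff ?gt_eqF // mulr1.
have e1 : s%:C * (w^*)%R = q%:C * z by rewrite wc mulrA sqs.
have e2 : s%:C * w = q%:C * (z^*)%R by rewrite /w mulrA sqs.
have cross : s%:C *: ((w^*)%R *: rank_one u h + w *: rank_one h u)
    = q%:C *: (z *: rank_one u h + (z^*)%R *: rank_one h u).
  rewrite !scalerDr !scalerA e1 e2; reflexivity.
clearbody u'; rewrite rk cross rank_oneZl rank_oneZr; reflexivity.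
Qed.

Lemma norm_transfer_lt_scaled (N : 'M[R[i]]_d -> R) A u h (a b c r : R) :
  is_norm N -> strictly_convex_norm N -> unitarily_invariant N ->
  A \is hermsymmx -> 0 < a -> inner u u = a%:C -> inner h h = 1 ->
  A *m u = b%:C *: u -> A *m h = c%:C *: h -> 0 < r < c - b ->
  N (A + r%:C *: ((a^-1)%:C *: rank_one u u - rank_one h h)) < N A.
Proof.
move=> Nn Nsc Nui hA a0 uu hh Au Ah rcb; rewrite -rank_one_normalized //.
apply: norm_transfer_lt Ah rcb => //; first exact: inner_normalized.
by rewrite -scalemxAr Au !scalerA mulrC.
Qed.

(** Tilting each [g i] toward [h] by an amount governed by its coefficient in the
    dependency leaves [A + frame_op g - frame_op g'] equal to [A] plus weights
    moved from [h] to the [g i]. With [tau] the total weight, this is the convex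
    combination of the operators in which all of [tau] is moved to a single
    [g i], and each of those has a smaller norm than [A]. *)
Lemma dependency_decreases_norm (N : 'M[R[i]]_d -> R) (k : nat)
    (A : 'M[R[i]]_d) (g : 'I_k -> 'cV[R[i]]_d) h (a : 'I_k -> R)
    (z : 'I_k -> R[i]) (b c e : R) (i0 : 'I_k) :
  is_norm N -> strictly_convex_norm N -> unitarily_invariant N ->
  A \is hermsymmx -> (forall i, 0 < a i) ->
  (forall i, inner (g i) (g i) = (a i)%:C) ->
  inner h h = 1 -> A *m h = c%:C *: h -> b < c ->
  (forall i, z i != 0 -> A *m g i = b%:C *: g i) ->
  \sum_i z i *: g i = 0 -> z i0 != 0 -> 0 < e ->
  exists g' : 'I_k -> 'cV[R[i]]_d,
    [/\ forall i, inner (g' i) (g' i) = (a i)%:C,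
        forall i, vnorm (g i - g' i) < e &
        N (A + frame_op g - frame_op g') < N A].
Proof.
move=> Nn Nsc Nui hA a0 gg hh Ah bc Ag zg zi0 e0.
pose m i := complex.Re (z i * (z i)^*)%R.
have m0 i : 0 <= m i by apply: Re_mul_conjC_ge0.
have ma0 i : 0 <= m i / a i by rewrite divr_ge0 // ltW.
pose M := \sum_i m i; pose K := \sum_i (m i / a i).
have M0 : 0 <= M by apply: sumr_ge0.
have K0 : 0 <= K by apply: sumr_ge0.
have bc0 : 0 < c - b by rewrite subr_gt0.
have le_sum1 (F : 'I_k -> R) i : (forall l, 0 <= F l) -> F i <= \sum_l F l.
  by move=> F0; rewrite (bigD1 i) //= lerDl sumr_ge0.
(* With q^2 X < 1, the three summands keep the tilting angles real, the total
   weight below c - b, and the tilted family within distance e. *)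
pose X := 4 * K + 2 * M / (c - b) + 4 * M / e ^+ 2.
have X1 : 0 <= 4 * K by rewrite mulr_ge0.
have X2 : 0 <= 2 * M / (c - b) by rewrite divr_ge0 ?mulr_ge0 // ltW.
have X3 : 0 <= 4 * M / e ^+ 2 by apply: divr_ge0; [exact: mulr_ge0 | exact: sqr_ge0].
have [|r r0 rX] := @small_pos R X; first by rewrite /X !addr_ge0.
pose q := Num.sqrt r; have q0 : 0 < q by rewrite sqrtr_gt0.
have q2 : q ^+ 2 = r by rewrite sqr_sqrtr // ltW.
have rK : 4 * (r * K) <= 1 by rewrite /X in rX; nra.
have rM1 : 2 * (r * M) < c - b.
  rewrite -[ltRHS]mul1r -ltr_pdivrMr //.
  have -> : 2 * (r * M) / (c - b) = r * (2 * M / (c - b)) by ring.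
  by rewrite /X in rX; nra.
have rM2 : 4 * (r * M) < e ^+ 2.
  rewrite -[ltRHS]mul1r -ltr_pdivrMr ?exprn_gt0 //.
  have -> : 4 * (r * M) / e ^+ 2 = r * (4 * M / e ^+ 2) by ring.
  by rewrite /X in rX; nra.
have ex i : exists t : R, exists u' : 'cV[R[i]]_d,
  [/\ [/\ 0 <= t, z i != 0 -> 0 < t & a i * t <= 2 * (q ^+ 2 * m i)],
     z i = 0 -> t = 0,
     inner u' u' = (a i)%:C, vnorm (g i - u') ^+ 2 <= 4 * (q ^+ 2 * m i) &
     rank_one u' u' = rank_one (g i) (g i) - t%:C *: rank_one (g i) (g i)
       + q%:C *: (rank_one (z i *: g i) h + rank_one h (z i *: g i))
       + (a i * t)%:C *: rank_one h h].
  apply: exists_tilt => //.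
    by move=> /Ag Agi; apply: (hermitian_eigen_orth hA Agi Ah); rewrite lt_eqF.
  rewrite q2; apply: le_trans rK; rewrite ler_pM2l ?ltr0n // ler_pM2l //.
  exact: (le_sum1 (fun i => m i / a i)).
have [t /fin_all_exists [g' Hg']] := fin_all_exists ex.
have t0 i : 0 <= t i by have [[]] := Hg' i.
have tpos i : z i != 0 -> 0 < t i by have [[]] := Hg' i.
have tz i : 0 < t i -> z i != 0.
  have [_ h0 _ _ _] := Hg' i; apply: contraTneq => /h0 ->; by rewrite ltxx.
have rk i : rank_one (g' i) (g' i) = rank_one (g i) (g i)
      - (t i)%:C *: rank_one (g i) (g i)
      + q%:C *: (rank_one (z i *: g i) h + rank_one h (z i *: g i))
      + (a i * t i)%:C *: rank_one h h by have [] := Hg' i.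
exists g'; split.
- by move=> i; have [] := Hg' i.
- move=> i; have [_ _ _ dist _] := Hg' i.
  rewrite -(ltr_pXn2r (ltn0Sn 1)) ?nnegrE ?sqrtr_ge0 // ?(ltW e0) //.
  apply: le_lt_trans dist _; rewrite q2; apply: le_lt_trans rM2.
  by rewrite ler_pM2l ?ltr0n // ler_pM2l // (le_sum1 m).
pose tau := \sum_i a i * t i.
have at0 i : 0 <= a i * t i by rewrite mulr_ge0 // ltW.
have tau0 : 0 < tau.
  apply: lt_le_trans (le_sum1 (fun i => a i * t i) i0 at0).
  by rewrite mulr_gt0 // tpos.
have taubc : tau < c - b.
  apply: le_lt_trans rM1; rewrite /M !mulr_sumr; apply: ler_sum => i _.
  by have [[_ _]] := Hg' i; rewrite q2.
pose p i := a i * t i / tau.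
have psum : \sum_i p i = 1 by rewrite -mulr_suml divff // gt_eqF.
pose T i := A + tau%:C *: (((a i)^-1)%:C *: rank_one (g i) (g i) - rank_one h h).
have -> : A + frame_op g - frame_op g' = \sum_i (p i)%:C *: T i.
  have cross : \sum_i (rank_one (z i *: g i) h + rank_one h (z i *: g i)) = 0.
    by rewrite big_split /= rank_one_suml rank_one_sumr zg rank_one0l rank_one0r addr0.
  have -> : \sum_i (p i)%:C *: T i = A
      + \sum_i ((t i)%:C *: rank_one (g i) (g i) - (a i * t i)%:C *: rank_one h h).
    rewrite -{1}[A]scale1r -[1]/(1%:C) -psum rmorph_sum /= scaler_suml -big_split /=.
    apply: eq_bigr => i _; rewrite scalerDr !scalerA scalerBr scalerA -!rmorphM /=.
    have -> : p i * tau / a i = t i.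
      by rewrite /p divfK ?gt_eqF // mulrAC divff ?gt_eqF // mul1r.
    by rewrite /p divfK // gt_eqF.
  rewrite -addrA; congr (_ + _); rewrite /frame_op -sumrB.
  have -> : \sum_i (rank_one (g i) (g i) - rank_one (g' i) (g' i))
      = \sum_i ((t i)%:C *: rank_one (g i) (g i) - (a i * t i)%:C *: rank_one h h)
        - q%:C *: \sum_i (rank_one (z i *: g i) h + rank_one h (z i *: g i)).
    rewrite scaler_sumr -sumrB; apply: eq_bigr => i _; rewrite rk.
    exact: tilt_combination.
  by rewrite cross scaler0 subr0.
apply: norm_convex_lt => // i; first by rewrite divr_ge0 // ltW.
rewrite /p pmulr_lgt0 ?invr_gt0 // pmulr_rgt0 // => /tz zi.
by apply: (norm_transfer_lt_scaled Nn Nsc Nui hA (a0 i) (gg i) hh (Ag i zi) Ah); rewrite tau0.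
Qed.

End Perturbation.

Theorem theorem4p7 (R : realType) (d k p : nat)
    (Smx : 'M[R[i]]_d) (a : 'I_k -> R) (N : 'M[R[i]]_d -> R)
    (g : 'I_k -> 'cV[R[i]]_d) (c : 'I_p -> R) (j : 'I_p) :
  psdmx Smx ->
  (forall i, 0 < a i) ->
  (forall i i' : 'I_k, (i <= i')%N -> a i' <= a i) ->
  is_norm N -> strictly_convex_norm N -> unitarily_invariant N ->
  local_minimizer (@torus R d k a) (@family_dist R d k) (Theta N Smx) g ->
  let S0 := frame_op g in
  let W := limg (mx_op S0) in
  (forall i i' : 'I_p, (i < i')%N -> c i < c i') ->
  (forall z : R[i], passmx.leigenvalue (restriction (mx_op (Smx - S0)) W) z <->
                    exists i : 'I_p, z = (c i)%:C) ->
  let J (i : 'I_p) := [set l : 'I_k | (Smx - S0) *m g l == (c i)%:C *: g l] in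
  (exists2 x : R, passmx.leigenvalue (mx_op (Smx - S0)) x%:C & c j < x) ->
  free [seq g l | l <- enum (J j)].
Proof.
move=> [hS _] a0 _ Nn Nsc Nui [gT [e e0 gmin]] S0 W _ _ J [x xeig cx].
have hA : Smx - S0 \is hermsymmx by rewrite hermitian_sub ?hermitian_frame_op.
have [h0 h0N0 Ah0] := leigenvalue_mx_op xeig.
have nh0 : 0 < vnorm h0 ^+ 2.
  rewrite lt_def sqr_ge0 andbT; apply: contra_neq h0N0 => n0.
  by apply: inner_self_eq0; rewrite inner_self_vnorm n0.
pose h := normalized (vnorm h0 ^+ 2) h0.
have hh : inner h h = 1 by apply: inner_normalized => //; apply: inner_self_vnorm.
have Ah : (Smx - S0) *m h = x%:C *: h by rewrite -scalemxAr Ah0 !scalerA mulrC.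
apply: free_map_enum => z zJ zg i0; apply/eqP/negPn/negP => zi0.
have gg i : inner (g i) (g i) = (a i)%:C by rewrite inner_self_vnorm gT.
have Ag i : z i != 0 -> (Smx - S0) *m g i = (c j)%:C *: g i.
  move=> zi; have : i \in J j by apply: contraR zi => /zJ ->.
  by rewrite inE => /eqP.
have [g' [gg' dist]] :=
  dependency_decreases_norm Nn Nsc Nui hA a0 gg hh Ah cx Ag zg zi0 e0.
rewrite subrK ltNge => /negP; apply; apply: gmin.
  by move=> i; apply: (@complexI R); rewrite -inner_self_vnorm gg'.
by apply: bigmax_lt => // i _; apply: dist.
Qed.
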